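(* Let $n\ge 1$, let $\varepsilon>0$, and set $v=\varepsilon^{-1}$, $\lambda=\varepsilon^{-2}$. Let $\det(L_{2n})$ be the differential operator in $(t,x_1,\dots,x_n)$ defined in the context. Then the equation $\det(L_{2n})f=0$ is regularly perturbed: after multiplying it by $\varepsilon^{4n-2}$ and by a nonzero constant depending only on $n$, it takes the form $$\frac{\partial}{\partial t}f=\frac{2n-1}{2n^{2}}\left(\frac{\partial^{2}}{\partial x_{1}^{2}}+\dots+\frac{\partial^{2}}{\partial x_{n}^{2}}\right)f+D_{\varepsilon}f,$$ where $D_{\varepsilon}=\varepsilon^{2}D_{1}+\varepsilon^{4}D_{2}+\cdots$ (a finite sum) and $D_1,D_2,\dots$ are differential operators in $(t,x_1,\dots,x_n)$ not depending on $\varepsilon$.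
   Context: For $v,\lambda>0$, $L_{2n}=(l_{ij})_{1\le i,j\le 2n}$ is the $2n\times 2n$ matrix whose entries are constant-coefficient (hence commuting) differential operators in $(t,x_1,\dots,x_n)$: $$l_{ii}=\frac{\partial}{\partial t}+(-1)^{i}v\frac{\partial}{\partial x_{\lceil i/2\rceil}}+\lambda,\qquad l_{ij}=-\frac{\lambda}{2n-1}\quad (i\ne j),$$ where $\lceil i/2\rceil$ is the least integer $\ge i/2$ (so the two indices $2m-1$ and $2m$ both correspond to the coordinate $x_m$, with opposite signs). $\det(L_{2n})$ is the determinant of this matrix, computed in the commutative ring of constant-coefficient differential operators; it is a polynomial in $\partial/\partial t,\partial/\partial x_1,\dots,\partial/\partial x_n$. Here $f$ is a function of $(t,x_1,\dots,x_n)$ to which these operators can be applied. *)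

(* Defs.v *)
From HB Require Import structures.
From mathcomp Require Import all_boot all_order all_algebra.
From mathcomp Require Import all_classical all_reals all_analysis.
(* Its notations are left out: they are incompatible with those of the analysis
   library. *)
From mathcomp.multinomials Require Import -(notations) mpoly.

Set Implicit Arguments.
Unset Strict Implicit.
Unset Printing Implicit Defensive.

Import Order.TTheory GRing.Theory Num.Theory.
Import numFieldNormedType.Exports.

Local Open Scope classical_set_scope.
Local Open Scope ring_scope.

(* The commutative ring of constant-coefficient real differential operators in
   d variables is the polynomial ring R[D_0, ..., D_(d-1)], where D_i stands
   for the partial derivative in the i-th variable and the product stands for
   composition. *)
Notation diffop R d := (mpoly.mpoly d R).

Section Operators.
Context {R : realType} {d : nat}.

(* The generator D_i. *)
Definition Dvar (i : 'I_d) : diffop R d :=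
  mpoly.mpolyX R (mpoly.mnm1 i).

Definition Dconst (c : R) : diffop R d := mpoly.mpolyC d c.

(* Order of an operator, plus one (0 for the null operator). *)
Definition diffop_size (P : diffop R d) : nat := mpoly.mmeasure mpoly.mdeg P.

End Operators.

Section Action.
Context {R : realType} {n : nat}.
Implicit Types (f : 'rV[R]_n.+1 -> R) (i : 'I_n.+1).

Definition pderiv i f : 'rV[R]_n.+1 -> R :=
  fun x => 'D_(delta_mx 0 i) f x.

(* pderivs [:: i1; ...; ik] f = D_i1 (... (D_ik f)) *)
Definition pderivs (s : seq 'I_n.+1) f : 'rV[R]_n.+1 -> R :=
  foldr pderiv f s.

(* f is of class C^k on U (meant for U open). *)
Definition class_C (U : set 'rV[R]_n.+1) (k : nat) f : Prop :=
  forall s : seq 'I_n.+1,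
    ((size s <= k)%N ->
       forall x, U x -> {for x, continuous (pderivs s f)}) /\
    ((size s < k)%N ->
       forall i x, U x -> derivable (pderivs s f) x (delta_mx 0 i)).

(* The monomial D_0^(m 0) ... D_n^(m n) applied to f. The order in which the
   partial derivatives are taken is immaterial for the functions of class C^k,
   k the degree of m. *)
Definition pderivm (m : mpoly.multinom n.+1) f : 'rV[R]_n.+1 -> R :=
  foldr (fun i g => iter (m i) (pderiv i) g) f (enum 'I_n.+1).

(* The operator P applied to f. *)
Definition diffop_apply (P : diffop R n.+1) f : 'rV[R]_n.+1 -> R :=
  fun x => \sum_(m <- mpoly.msupp P) mpoly.mcoeff m P * pderivm m f x.

End Action.

(* Variable 0 is t, variable k with 1 <= k <= n is x_k. The rows and columns
   of the matrix are numbered from 0, so that row i below is row i+1 of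
   L_2n; there, uphalf (i+1) is the ceiling of (i+1)/2. *)
Definition Lmx (R : realType) (n : nat) (v lambda : R) :
    'M[diffop R n.+1]_(2 * n) :=
  \matrix_(i < 2 * n, j < 2 * n)
    if i == j then
      Dvar ord0 + ((-1) ^+ i.+1 * v) *: Dvar (inord (uphalf i.+1))
        + Dconst lambda
    else Dconst (- (lambda / (2 * n%:R - 1))).

(* Main.v *)
Require Import Defs.
From HB Require Import structures.
From mathcomp Require Import all_boot all_order all_algebra.
From mathcomp Require Import all_classical all_reals all_analysis.
From mathcomp.multinomials Require Import -(notations) mpoly.
From mathcomp Require Import ring.

Set Implicit Arguments.
Unset Strict Implicit.
Unset Printing Implicit Defensive.

Import Order.TTheory GRing.Theory Num.Theory.
Import numFieldNormedType.Exports.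

Local Open Scope classical_set_scope.
Local Open Scope ring_scope.

(** Write s = eps^2 and b = 2n/(2n-1). Multiplied by s/b, the matrix has the
    diagonal entries d_i - 1/(2n), where d_i = 1 + s T -+ eps Y_m with
    T = D_t/b and Y_m = D_(x_m)/b, and all its other entries are -1/(2n): it is
    a diagonal matrix minus a constant one. Hence its determinant is
    prod_i d_i - 1/(2n) * sum_i prod_(j != i) d_j ([det_diag_subJ]). The two
    entries attached to x_m have the sum 2 (1 + s T) and the product
    (1 + s T)^2 - s Y_m^2, so that eps enters only through s: the determinant
    is the value at s of the polynomial [telegraph_poly], whose coefficients
    are operators free of eps ([horner_telegraph_poly], [det_Lmx_rescaled]).

    The constant coefficient of this polynomial vanishes, and its coefficient of
    s is T - (1/n) * sum_m Y_m^2 ([coef0_telegraph_poly],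
    [coef1_telegraph_poly]); multiplied by b, the latter is the heat operator
    with diffusion constant 1/(n b) = (2n-1)/(2n^2). Dividing by s leaves the
    heat operator plus terms in s, s^2, ..., which are the D_k up to the factor
    -b. The order of D_k is at most 2n because that of every coefficient is
    ([telegraph_poly_order]).

    The equivalence of the two equations follows from this identity between
    operators, because applying an operator to a function is linear in the
    operator ([diffop_applyD], [diffop_applyZ]). *)

(** * Determinant of a diagonal matrix minus a constant one *)

(** The elementary symmetric polynomial of degree n-1 in F 0, ..., F (n-1). *)
Definition omit1_sum (A : comNzRingType) (F : nat -> A) (n : nat) : A :=
  \sum_(i < n) \prod_(j < n | j != i) F j.

Lemma omit1_sumS (A : comNzRingType) (F : nat -> A) (n : nat) :
  omit1_sum F n.+1
    = \prod_(i < n) F i.+1 + F 0%N * omit1_sum (fun i => F i.+1) n.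
Proof.
rewrite /omit1_sum big_ord_recl; congr (_ + _).
  rewrite big_mkcond big_ord_recl /= mul1r.
  by apply: eq_bigr => j _.
rewrite mulr_sumr; apply: eq_bigr => i _.
rewrite big_mkcond big_ord_recl /=; congr (_ * _).
rewrite [RHS]big_mkcond; apply: eq_bigr => j _.
by rewrite (inj_eq (@lift_inj _ _)).
Qed.

(** By linearity in the first row, which is d 0 times a unit vector minus k
    times the all-ones vector. The unit vector leaves the matrix of size n; with
    the all-ones row, clearing the first column leaves a diagonal matrix. *)
Lemma det_diag_subJ (A : comNzRingType) (d : nat -> A) (k : A) (n : nat) :
  \det (\matrix_(i < n, j < n) (d i *+ (i == j) - k))
    = \prod_(i < n) d i - k * omit1_sum d n.
Proof.
elim: n d => [|n IHn] d.
  by rewrite det_mx00 /omit1_sum !big_ord0 mulr0 subr0.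
pose M := \matrix_(i < n, j < n) (d i.+1 *+ (i == j) - k).
pose B := block_mx (1 : 'M[A]_1) 0 (const_mx (- k)) M.
pose D := \matrix_(i < n, j < n) (d i.+1 *+ (i == j)).
pose C := block_mx (1 : 'M[A]_1) (const_mx 1) (const_mx (- k)) M.
have detC : \det C = \prod_(i < n) d i.+1.
  have -> : C = block_mx (1%:M : 'M[A]_1) 0 (const_mx (- k)) 1%:M *m
                block_mx (1%:M : 'M[A]_1) (const_mx 1) 0 D.
    rewrite mulmx_block !mul1mx !mulmx1 !mul0mx ?mulmx0 !addr0.
    congr block_mx; apply/matrixP => i j.
    by rewrite !mxE big_ord1 !mxE mulr1 addrC.
  rewrite det_mulmx det_lblock det_ublock !det1 !mul1r.
  have -> : D = diag_mx (\row_(i < n) d i.+1).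
    by apply/matrixP => i j; rewrite !mxE.
  by rewrite det_diag; apply: eq_bigr => i _; rewrite mxE.
have -> : \matrix_(i < n.+1, j < n.+1) (d i *+ (i == j) - k)
    = block_mx ((d 0%N - k)%:M : 'M[A]_1) (const_mx (- k)) (const_mx (- k)) M.
  apply/matrixP => i j; rewrite mxE.
  rewrite -[n.+1]/(1 + n)%N in i j *.
  case: (split_ordP i) => i' ->; case: (split_ordP j) => j' ->.
  - by rewrite block_mxEul !ord1 !mxE eqxx.
  - by rewrite block_mxEur !mxE eq_lrshift add0r.
  - by rewrite block_mxEdl !mxE eq_rlshift add0r.
  - by rewrite block_mxEdr !mxE eq_rshift.
rewrite (@determinant_multilinear _ (1 + n) _ B C (lshift n 0) (d 0%N) (- k)).
- rewrite (@det_lblock _ 1) det1 mul1r (IHn (fun i => d i.+1)) detC.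
  by rewrite omit1_sumS big_ord_recl /=; ring.
- rewrite !rowKu !row_row_mx !scale_row_mx add_row_mx.
  congr row_mx; apply/rowP => j; rewrite ?ord1 !mxE ?eqxx /=; ring.
- rewrite !(@row'Ku _ 0).
  by apply: (congr1 (fun X => @col_mx _ 0 _ _ X _)); apply/matrixP => -[].
- rewrite !(@row'Ku _ 0).
  by apply: (congr1 (fun X => @col_mx _ 0 _ _ X _)); apply/matrixP => -[].
Qed.

Lemma prod_pairs (A : comNzRingType) (F : nat -> A) (n : nat) :
  \prod_(i < n.*2) F i = \prod_(m < n) (F m.*2 * F m.*2.+1).
Proof.
elim: n F => [|n IHn] F; first by rewrite !big_ord0.
rewrite doubleS !big_ord_recl /= mulrA; congr (_ * _).
exact: (IHn (fun i => F i.+2)).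
Qed.

(** Omitting one entry leaves its partner in the pair; the two products so
    obtained from a pair add up to s times the product of the other pairs. *)
Lemma omit1_sum_pairs (A : comNzRingType) (F : nat -> A) (s : A) (n : nat) :
    (forall m, F m.*2 + F m.*2.+1 = s) ->
  omit1_sum F n.*2 = s * omit1_sum (fun m => F m.*2 * F m.*2.+1) n.
Proof.
elim: n F => [|n IHn] F Fs; first by rewrite /omit1_sum !big_ord0 mulr0.
rewrite doubleS !omit1_sumS big_ord_recl /=.
rewrite (IHn (fun i => F i.+2)) => [|m]; last exact: (Fs m.+1).
rewrite (prod_pairs (fun i => F i.+2)) -(Fs 0%N) /=; ring.
Qed.

(** * First-order expansion of the determinant polynomial *)

Lemma coef0_prod1 (A : comNzRingType) (Q : nat -> {poly A}) (n : nat) :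
  (forall m, (Q m)`_0 = 1) -> (\prod_(m < n) Q m)`_0 = 1.
Proof. by move=> Q0; rewrite coef0_prod big1. Qed.

Lemma coef1_prod1 (A : comNzRingType) (Q : nat -> {poly A}) (n : nat) :
    (forall m, (Q m)`_0 = 1) ->
  (\prod_(m < n) Q m)`_1 = \sum_(m < n) (Q m)`_1.
Proof.
elim: n => [|n IHn] Q0; first by rewrite !big_ord0 coefC.
rewrite !big_ord_recr /= coefM !big_ord_recl big_ord0 /= !subn0 addr0.
by rewrite coef0_prod1 // Q0 mul1r mulr1 IHn // addrC.
Qed.

Lemma coef0_omit1_sum (A : comNzRingType) (Q : nat -> {poly A}) (n : nat) :
  (forall m, (Q m)`_0 = 1) -> (omit1_sum Q n)`_0 = n%:R.
Proof.
move=> Q0; rewrite /omit1_sum coef_sum.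
under eq_bigr do rewrite coef0_prod big1 //.
by rewrite sumr_const card_ord.
Qed.

(** Each of the n products contributes the sum of its n-1 linear
    coefficients. *)
Lemma coef1_omit1_sum (A : comNzRingType) (Q : nat -> {poly A}) (n : nat) :
    (forall m, (Q m)`_0 = 1) ->
  (omit1_sum Q n)`_1 = (n%:R - 1) * \sum_(m < n) (Q m)`_1.
Proof.
elim: n Q => [|n IHn] Q Q0.
  by rewrite /omit1_sum !big_ord0 coef0 mulr0.
rewrite omit1_sumS coefD (coef1_prod1 _ (fun m => Q0 m.+1)) coefM.
rewrite !big_ord_recl big_ord0 /= !subn0 Q0 (IHn _ (fun m => Q0 m.+1)).
by rewrite coef0_omit1_sum //= -natr1; ring.
Qed.

(** The polynomial variable stands for eps^2. This is half the sum of the two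
    entries d_i attached to one space variable. *)
Definition drift (A : comNzRingType) (T : A) : {poly A} := 1 + T *: 'X.

(** The product of the two entries d_i attached to one space variable. *)
Definition pair_factor (A : comNzRingType) (T y : A) : {poly A} :=
  drift T ^+ 2 - y ^+ 2 *: 'X.

(** Here u stands for 1/n; it is the coefficient 1/(2n) of [omit1_sum] in the
    determinant times the factor 2 in the sum of a pair. *)
Definition telegraph_poly (A : comNzRingType) (u T : A) (Y : nat -> A)
    (n : nat) : {poly A} :=
  \prod_(m < n) pair_factor T (Y m)
    - u *: (drift T * omit1_sum (fun m => pair_factor T (Y m)) n).

Lemma coef0_drift (A : comNzRingType) (T : A) : (drift T)`_0 = 1.
Proof. by rewrite coefD coefZ coefX coef1 mulr0 addr0. Qed.

Lemma coef1_drift (A : comNzRingType) (T : A) : (drift T)`_1 = T.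
Proof. by rewrite coefD coefZ coefX coef1 mulr1 add0r. Qed.

Lemma coef0_pair_factor (A : comNzRingType) (T y : A) :
  (pair_factor T y)`_0 = 1.
Proof. by rewrite coefB coefZ coefX mulr0 subr0 coef0M coef0_drift mulr1. Qed.

Lemma coef1_pair_factor (A : comNzRingType) (T y : A) :
  (pair_factor T y)`_1 = 2 * T - y ^+ 2.
Proof.
rewrite coefB coefZ coefX mulr1 coefM !big_ord_recl big_ord0 /= !subn0.
by rewrite coef0_drift coef1_drift; ring.
Qed.

Lemma coef0_telegraph_poly (A : comNzRingType) (u T : A) (Y : nat -> A) n :
  u * n%:R = 1 -> (telegraph_poly u T Y n)`_0 = 0.
Proof.
move=> un1; have Q0 m := coef0_pair_factor T (Y m).
rewrite coefB coefZ coef0M coef0_drift mul1r coef0_omit1_sum // un1.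
by rewrite (coef0_prod1 _ Q0) subrr.
Qed.

Lemma coef1_telegraph_poly (A : comNzRingType) (u T : A) (Y : nat -> A) n :
    u * n%:R = 1 ->
  (telegraph_poly u T Y n)`_1 = T - u * \sum_(m < n) Y m ^+ 2.
Proof.
move=> un1; have Q0 m := coef0_pair_factor T (Y m).
rewrite coefB coefZ (coef1_prod1 _ Q0) coefM !big_ord_recl big_ord0 /= !subn0.
rewrite coef0_drift coef1_drift coef0_omit1_sum // coef1_omit1_sum //.
under eq_bigr do rewrite coef1_pair_factor.
rewrite sumrB sumr_const card_ord -mulr_natl.
set q := \sum_(_ < _) _.
(* In this form u occurs either alone or in the product u * n = 1. *)
transitivity (T * (2 * n%:R - (u * n%:R) * (2 * n%:R - 1))
   - q * (1 - u * n%:R + u)); first by ring.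
by rewrite un1; ring.
Qed.

(** * The polynomial as a determinant *)

Lemma horner_omit1_sum (A : comNzRingType) (Q : nat -> {poly A}) n (x : A) :
  (omit1_sum Q n).[x] = omit1_sum (fun m => (Q m).[x]) n.
Proof.
rewrite /omit1_sum horner_sum; apply: eq_bigr => i _.
exact: horner_prod.
Qed.

Lemma eq_omit1_sum (A : comNzRingType) (F G : nat -> A) n :
  F =1 G -> omit1_sum F n = omit1_sum G n.
Proof.
by move=> FG; apply: eq_bigr => i _; apply: eq_bigr => j _; apply: FG.
Qed.

Lemma horner_telegraph_poly (A : comNzRingType) (u k T e : A) (Y : nat -> A) n :
    k * 2 = u ->
  let d i := 1 + e ^+ 2 * T + (-1) ^+ i.+1 * (e * Y i./2) in
  (telegraph_poly u T Y n).[e ^+ 2]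
    = \det (\matrix_(i < 2 * n, j < 2 * n) (d i *+ (i == j) - k)).
Proof.
move=> ku d; rewrite det_diag_subJ mul2n prod_pairs.
have dE m : d m.*2 = 1 + e ^+ 2 * T - e * Y m.
  by rewrite /d doubleK -signr_odd /= odd_double; ring.
have dO m : d m.*2.+1 = 1 + e ^+ 2 * T + e * Y m.
  by rewrite /d -uphalfE uphalf_double -signr_odd /= odd_double; ring.
rewrite (@omit1_sum_pairs _ _ (2 * (1 + e ^+ 2 * T))) => [|m]; last first.
  by rewrite dE dO; ring.
have Sx : (drift T).[e ^+ 2] = 1 + e ^+ 2 * T.
  by rewrite /drift hornerD hornerZ hornerX -polyC1 hornerC mulrC.
have Qx m : (pair_factor T (Y m)).[e ^+ 2] = d m.*2 * d m.*2.+1.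
  rewrite /pair_factor hornerD hornerN hornerZ hornerX horner_exp Sx dE dO.
  by ring.
rewrite hornerD hornerN hornerZ hornerM horner_prod Sx horner_omit1_sum.
rewrite (eq_omit1_sum _ Qx) (eq_bigr _ (fun (m : 'I_n) _ => Qx m)) -ku; ring.
Qed.

(** * Orders of the coefficients *)

Section Order.
Context {R : realType} {d : nat}.
Implicit Types (P Q : diffop R d) (p q : {poly diffop R d}).

Lemma diffop_sizeM_le P Q :
  (diffop_size (P * Q)%R <= (diffop_size P + diffop_size Q).-1)%N.
Proof.
have [->|P0] := eqVneq P 0; first by rewrite mul0r /diffop_size mmeasure0.
have [->|Q0] := eqVneq Q 0; first by rewrite mulr0 /diffop_size mmeasure0.
by rewrite /diffop_size msizeM.
Qed.

Definition coef_order_le (k : nat) p : Prop :=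
  forall i, (diffop_size (p`_i)%R <= k.+1)%N.

Lemma coef_order_leW k l p : (k <= l)%N -> coef_order_le k p ->
  coef_order_le l p.
Proof. by move=> kl pk i; apply: leq_trans (pk i) _. Qed.

Lemma coef_order_leD k p q :
  coef_order_le k p -> coef_order_le k q -> coef_order_le k (p + q).
Proof.
move=> pk qk i; rewrite coefD; apply: leq_trans (mmeasureD_le _ _ _) _.
by rewrite geq_max; apply/andP; split; [exact: pk | exact: qk].
Qed.

Lemma coef_order_leN k p : coef_order_le k p -> coef_order_le k (- p).
Proof. by move=> pk i; rewrite coefN /diffop_size mmeasureN; exact: pk. Qed.

Lemma coef_order_leM k l p q :
  coef_order_le k p -> coef_order_le l q -> coef_order_le (k + l) (p * q).
Proof.
move=> pk ql i; rewrite coefM; apply: leq_trans (mmeasure_sum _ _ _ _) _.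
apply/bigmax_leqP => j _; apply: leq_trans (diffop_sizeM_le _ _) _.
rewrite -subn1 leq_subLR add1n -addSn -addnS.
by apply: leq_add; [exact: pk | exact: ql].
Qed.

Lemma coef_order_leC k P :
  (diffop_size P <= k.+1)%N -> coef_order_le k P%:P.
Proof.
by move=> Pk i; rewrite coefC; case: eqP => //; rewrite /diffop_size mmeasure0.
Qed.

Lemma coef_order_leX : coef_order_le 0 'X.
Proof.
move=> i; rewrite coefX; case: eqP => _ /=.
  by rewrite /diffop_size mmeasure1.
by rewrite /diffop_size mmeasure0.
Qed.

Lemma coef_order_le_sum k (I : finType) (F : I -> {poly diffop R d}) :
  (forall i, coef_order_le k (F i)) -> coef_order_le k (\sum_i F i).
Proof.
move=> Fk; elim/big_ind: _ => [i|p q pk qk|i _]; [|exact: coef_order_leD|].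
  by rewrite coef0 /diffop_size mmeasure0.
exact: Fk.
Qed.

Lemma coef_order_le_prod k (I : finType) (B : pred I)
    (F : I -> {poly diffop R d}) :
    (forall i, coef_order_le k (F i)) ->
  coef_order_le (#|B| * k) (\prod_(i | B i) F i).
Proof.
move=> Fk; rewrite -sum_nat_const.
elim/big_rec2: _ => [|i k' p Bi pk]; last exact: coef_order_leM.
by apply: coef_order_leC; rewrite /diffop_size mmeasure1.
Qed.

(** A coefficient of [drift] has order at most 1 and one of [pair_factor] order
    at most 2; there are n factors of the latter kind in the first term, n-1 of
    them and one of the former in the second. *)
Lemma telegraph_poly_order (u T : diffop R d) (Y : nat -> diffop R d) n :
    (0 < n)%N -> (diffop_size u <= 1)%N -> (diffop_size T <= 2)%N ->
    (forall m, (diffop_size (Y m) <= 2)%N) ->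
  coef_order_le (2 * n) (telegraph_poly u T Y n).
Proof.
move=> n0 u1 T2 Y2.
have S1 : coef_order_le 1 (drift T).
  apply: coef_order_leD.
    by apply: coef_order_leC; rewrite /diffop_size mmeasure1.
  rewrite -mul_polyC -[1%N]addn0.
  by apply: coef_order_leM coef_order_leX; apply: coef_order_leC.
have Q2 m : coef_order_le 2 (pair_factor T (Y m)).
  apply: coef_order_leD.
    by rewrite expr2; exact: (coef_order_leM S1 S1).
  apply: coef_order_leN; rewrite -mul_polyC -[2%N]addn0.
  apply: coef_order_leM coef_order_leX; apply: coef_order_leC.
  rewrite expr2; apply: leq_trans (diffop_sizeM_le _ _) _.
  by rewrite -subn1 leq_subLR; exact: (@leq_add _ _ 2 2).
apply: coef_order_leD.
  have := @coef_order_le_prod 2 'I_n predT _ (fun m => Q2 m).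
  by rewrite card_ord mulnC.
apply: coef_order_leN; rewrite -mul_polyC.
apply: (@coef_order_leW (0 + (1 + n.-1 * 2))).
  by case: n n0 => // n _; rewrite add0n (mulnC _ 2) mulnS leq_add2r.
apply: coef_order_leM; first exact: coef_order_leC.
apply: (coef_order_leM S1); apply: coef_order_le_sum => i.
have := coef_order_le_prod (predC1 i) (fun m : 'I_n => Q2 m).
by rewrite cardC1 card_ord.
Qed.

End Order.

(** * Applying an operator to a function *)

Section Application.
Context {R : realType} {n : nat}.
Implicit Types (P Q : diffop R n.+1) (f : 'rV[R]_n.+1 -> R).

(** Lets two operators be summed over a common list of monomials. *)
Lemma diffop_apply_supp P (s : seq (multinom n.+1)) f x :
    uniq s -> {subset msupp P <= s} ->
  diffop_apply P f x = \sum_(m <- s) mcoeff m P * pderivm m f x.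
Proof.
move=> us sub; rewrite /diffop_apply.
rewrite [RHS](bigID (mem (msupp P))) /= [X in _ + X]big1 ?addr0; last first.
  by move=> m; rewrite mcoeff_msupp negbK => /eqP ->; rewrite mul0r.
rewrite -[RHS]big_filter; apply: perm_big; apply: uniq_perm.
- exact: msupp_uniq.
- exact: filter_uniq.
- by move=> m; rewrite mem_filter andb_idr // => /sub.
Qed.

Lemma diffop_applyD P Q f x :
  diffop_apply (P + Q) f x = diffop_apply P f x + diffop_apply Q f x.
Proof.
set s := undup (msupp P ++ msupp Q).
have us : uniq s by exact: undup_uniq.
rewrite !(@diffop_apply_supp _ s) //.
- by rewrite -big_split; apply: eq_bigr => m _; rewrite mcoeffD mulrDl.
- by move=> m mQ; rewrite mem_undup mem_cat mQ orbT.
- by move=> m mP; rewrite mem_undup mem_cat mP.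
- by move=> m /msuppD_le; rewrite mem_undup.
Qed.

Lemma diffop_applyZ a P f x :
  diffop_apply (a *: P) f x = a * diffop_apply P f x.
Proof.
rewrite !(@diffop_apply_supp _ (msupp P)) ?msupp_uniq //; last exact: msuppZ_le.
by rewrite mulr_sumr; apply: eq_bigr => m _; rewrite mcoeffZ mulrA.
Qed.

Lemma diffop_applyB P Q f x :
  diffop_apply (P - Q) f x = diffop_apply P f x - diffop_apply Q f x.
Proof. by rewrite -scaleN1r diffop_applyD diffop_applyZ mulN1r. Qed.

Lemma diffop_apply_sum (I : Type) (r : seq I) (B : pred I)
    (F : I -> diffop R n.+1) f x :
  diffop_apply (\sum_(i <- r | B i) F i) f x
    = \sum_(i <- r | B i) diffop_apply (F i) f x.
Proof.
apply: (big_morph (fun P => diffop_apply P f x)) => [P Q|].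
  exact: diffop_applyD.
by rewrite /diffop_apply msupp0 big_nil.
Qed.

Lemma pderivm_pure (i : 'I_n.+1) k f :
  pderivm (mnm_muln (mnm1 i) k) f = iter k (pderiv i) f.
Proof.
rewrite /pderivm.
have -> : iter k (pderiv i) f
    = if i \in enum 'I_n.+1 then iter k (pderiv i) f else f.
  by rewrite mem_enum.
elim: (enum _) (enum_uniq 'I_n.+1) => //= j s IHs /andP[js us].
rewrite IHs // in_cons mulmnE mnm1E.
case: (eqVneq i j) js => [<-|_] js; last by rewrite mul0n.
by rewrite mul1n (negbTE js).
Qed.

Lemma diffop_apply_DvarX (i : 'I_n.+1) k f x :
  diffop_apply (Dvar i ^+ k) f x = iter k (pderiv i) f x.
Proof.
rewrite /Dvar mpolyXn /diffop_apply msuppX big_seq1 mcoeffX eqxx mul1r.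
by rewrite pderivm_pure.
Qed.

End Application.

(** * The rescaled matrix *)

Lemma two_n_sub1_neq0 (R : realType) (n : nat) :
  (0 < n)%N -> 2 * n%:R - 1 != 0 :> R.
Proof.
move=> n_gt0.
by rewrite subr_eq0 -natrM (eqr_nat R _ 1) gtn_eqF // mul2n (leq_double 1).
Qed.

Section Rescaling.
Context (R : realType) (n : nat).

(** The part of order 0 in eps of a diagonal entry of
    eps^2 L + J/(2n-1), where J is the all-ones matrix. *)
Definition diag_scale : R := 2 * n%:R / (2 * n%:R - 1).
Local Notation b := diag_scale.

Definition unit_drift : diffop R n.+1 := b^-1 *: Dvar ord0.
Definition unit_shift (m : nat) : diffop R n.+1 := b^-1 *: Dvar (inord m.+1).

(** The factor eps^2/b turns the off-diagonal entries into -1/(2n) and the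
    constant part of the diagonal ones into 1/b = 1 - 1/(2n). *)
Lemma det_Lmx_rescaled (eps : R) : (0 < n)%N -> eps != 0 ->
  (eps ^+ 2 / b) ^+ (2 * n) *: \det (@Lmx R n eps^-1 (eps ^- 2))
    = (telegraph_poly (n%:R^-1)%:A unit_drift unit_shift n).[(eps ^+ 2)%:A].
Proof.
move=> n_gt0 e_neq0.
have n_neq0 : n%:R != 0 :> R by rewrite pnatr_eq0 -lt0n.
have m_neq0 := two_n_sub1_neq0 R n_gt0.
have algX (a : R) k : (a ^+ k)%:A = a%:A ^+ k :> diffop R n.+1.
  by rewrite exprZn expr1n.
rewrite -[LHS]mulr_algl algX -detZ algX.
rewrite (@horner_telegraph_poly _ _ ((2 * n%:R)^-1)%:A); last first.
  by rewrite mulr_natr scalerMnl; congr (_ *: _); field; rewrite n_neq0.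
congr (\det _); apply/matrixP => i j; rewrite !mxE mulr_algl.
have [_|_] := eqVneq i j; last first.
  rewrite add0r /Dconst -alg_mpolyC scalerA -[RHS]scaleNr; congr (_ *: _).
  by rewrite /b; field; rewrite n_neq0 m_neq0 e_neq0.
have -> : (-1) ^+ i.+1 = ((-1) ^+ i.+1)%:A :> diffop R n.+1.
  by rewrite -in_algE rmorphXn rmorphN rmorph1.
rewrite /Dconst -alg_mpolyC exprZn expr1n !mulr_algl !scalerDr !scalerA.
rewrite mulr1n.
set D0 := Dvar ord0; set D1 := Dvar (inord _).
have -> : eps ^+ 2 / b * ((-1) ^+ i.+1 / eps) = (-1) ^+ i.+1 * eps / b.
  by rewrite /b; field; rewrite n_neq0 m_neq0 e_neq0.
have -> : eps ^+ 2 / b / eps ^+ 2 = 1 - (2 * n%:R)^-1.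
  by rewrite /b; field; rewrite n_neq0 m_neq0 e_neq0.
rewrite scalerBl scale1r [1 + _ in RHS]addrC.
by rewrite (addrAC _ 1) addrA.
Qed.
End Rescaling.

(** * The regularly perturbed heat equation *)

Theorem mainTheorem2 (R : realType) (n : nat) (hn : (1 <= n)%N) :
  exists (c : R) (N : nat) (D : nat -> diffop R n.+1),
    [/\ c != 0,
        forall k, (diffop_size (D k) <= (2 * n).+1)%N
      & forall eps : R, 0 < eps ->
          let P := \det (@Lmx R n (eps^-1) (eps ^- 2)) in
          (c * eps ^+ (4 * n - 2)) *: P =
            Dvar ord0
            - (((2 * n%:R - 1) / (2 * n%:R ^+ 2)) *:
                 (\sum_(m < n) Dvar (lift ord0 m) ^+ 2)
               + \sum_(1 <= k < N.+1) eps ^+ (2 * k) *: D k)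
          /\
          forall (U : set 'rV[R]_n.+1) (f : 'rV[R]_n.+1 -> R),
            open U -> class_C U (2 * n) f ->
            ((forall x, U x -> diffop_apply P f x = 0) <->
             (forall x, U x ->
                pderiv ord0 f x =
                  (2 * n%:R - 1) / (2 * n%:R ^+ 2) *
                    (\sum_(m < n)
                       pderiv (lift ord0 m) (pderiv (lift ord0 m) f) x)
                  + \sum_(1 <= k < N.+1)
                      eps ^+ (2 * k) * diffop_apply (D k) f x))].
Proof.
have n_neq0 : n%:R != 0 :> R by rewrite pnatr_eq0 -lt0n.
have m_neq0 := two_n_sub1_neq0 R hn.
set b := diag_scale R n.
have b_neq0 : b != 0.
  by rewrite /b /diag_scale mulf_neq0 ?invr_eq0 // mulf_neq0 // pnatr_eq0.
set G := telegraph_poly (n%:R^-1)%:A (unit_drift R n) (unit_shift R n) n.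
have c_neq0 : b^-1 ^+ (2 * n).-1 != 0 by rewrite expf_neq0 // invr_eq0.
(* The constant is b times the factor b^(-2n) of the rescaled determinant; D k
   is the coefficient of s^(k+1) because of the division by s, and -b because
   the D k are subtracted. *)
exists (b^-1 ^+ (2 * n).-1), (size G), (fun k => (- b) *: G`_k.+1).
split=> [//|k|eps eps_gt0 P].
  apply: leq_trans (mmeasureZ_le _ _ _) _.
  apply: telegraph_poly_order => // [||m].
  - rewrite /diffop_size; apply: leq_trans (mmeasureZ_le _ _ _) _.
    by rewrite mmeasure1.
  - apply: leq_trans (mmeasureZ_le _ _ _) _.
    by rewrite msizeX mdeg1.
  - apply: leq_trans (mmeasureZ_le _ _ _) _.
    by rewrite msizeX mdeg1.
have e_neq0 : eps != 0 by rewrite gt_eqF.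
have normal_form : (b^-1 ^+ (2 * n).-1 * eps ^+ (4 * n - 2)) *: P =
    Dvar ord0
    - (((2 * n%:R - 1) / (2 * n%:R ^+ 2)) *:
         (\sum_(m < n) Dvar (lift ord0 m) ^+ 2)
       + \sum_(1 <= k < (size G).+1) eps ^+ (2 * k) *: ((- b) *: G`_k.+1)).
  have -> : b^-1 ^+ (2 * n).-1 * eps ^+ (4 * n - 2)
      = b / eps ^+ 2 * (eps ^+ 2 / b) ^+ (2 * n).
    have -> : (4 * n - 2 = 2 * (2 * n).-1)%N by rewrite -subn1 mulnBr mulnA.
    rewrite exprM -exprMn [_^-1 * _]mulrC.
    rewrite -[in RHS](@prednK (2 * n)) ?muln_gt0 //.
    rewrite (exprS _ (2 * n).-1) mulrA -[LHS]mul1r; congr (_ * _).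
    by field; rewrite b_neq0.
  have detP : (eps ^+ 2 / b) ^+ (2 * n) *: P = G.[(eps ^+ 2)%:A].
    exact: det_Lmx_rescaled.
  rewrite -[LHS]scalerA detP.
  have unN : (n%:R^-1)%:A * n%:R = 1 :> diffop R n.+1.
    by rewrite mulr_natr scalerMnl -mulr_natr mulVf // scale1r.
  (* Two terms more than needed: those of degree 0 and 1 are split off, and
     size G terms remain, as in the sum over k. *)
  rewrite (@horner_coef_wide _ (size G).+2); last by rewrite -addn2 leq_addr.
  rewrite !big_ord_recl /= (coef0_telegraph_poly _ _ unN) mul0r add0r.
  rewrite (coef1_telegraph_poly _ _ unN).
  rewrite big_add1 big_mkord /= scalerDr.
  rewrite expr1 opprD addrA; congr (_ + _).
    rewrite mulr_algr scalerA divfK ?expf_neq0 // scalerBr mulr_algl.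
    rewrite /unit_drift scalerA divff // scale1r; congr (_ - _).
    rewrite !scaler_sumr; apply: eq_bigr => m _.
    rewrite /unit_shift exprZn !scalerA (_ : inord _ = lift ord0 m); last first.
      by apply: val_inj; rewrite /= inordK // ltnS.
    congr (_ *: _); rewrite -/b /b /diag_scale.
    by field; rewrite n_neq0 m_neq0.
  rewrite scaler_sumr -sumrN; apply: eq_bigr => k _.
  rewrite /bump /= !add1n exprZn expr1n mulr_algr !scalerA -scaleNr.
  congr (_ *: _); rewrite -exprM !mulnS !exprD.
  by field; rewrite e_neq0.
split=> // U f _ _.
have applied x :
    b^-1 ^+ (2 * n).-1 * eps ^+ (4 * n - 2) * diffop_apply P f x =
    pderiv ord0 f x -
      ((2 * n%:R - 1) / (2 * n%:R ^+ 2) *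
         (\sum_(m < n) pderiv (lift ord0 m) (pderiv (lift ord0 m) f) x)
       + \sum_(1 <= k < (size G).+1)
           eps ^+ (2 * k) * diffop_apply ((- b) *: G`_k.+1) f x).
  rewrite -diffop_applyZ normal_form diffop_applyB diffop_applyD diffop_applyZ.
  rewrite !diffop_apply_sum -[Dvar ord0]expr1 diffop_apply_DvarX.
  congr (_ - (_ * _ + _)).
    by apply: eq_bigr => m _; rewrite diffop_apply_DvarX.
  by apply: eq_bigr => k _; rewrite diffop_applyZ.
have a_neq0 : b^-1 ^+ (2 * n).-1 * eps ^+ (4 * n - 2) != 0.
  by rewrite mulf_neq0 // expf_neq0.
split=> eqf x Ux.
  by apply/eqP; rewrite -subr_eq0 -applied eqf // mulr0.
by apply: (mulfI a_neq0); rewrite applied eqf // subrr mulr0.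
Qed.
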